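(* There exists a singly-even binary self-dual $[64,32,12]$ code whose weight enumerator is of the form $$W_{64,2}=1+(1312+16\alpha)x^{12}+(23040-64\alpha)x^{14}+\cdots$$ with $\alpha=53$.
   Context: A binary $[n,k,d]$ code is a $k$-dimensional linear subspace of $\mathbb{F}_2^n$ with minimum Hamming distance $d$. It is self-dual if it equals its dual with respect to the Euclidean inner product $\langle\mathbf{x},\mathbf{y}\rangle=\sum_i x_iy_i$. A binary self-dual code is singly-even (Type I) if not all of its codeword weights are divisible by 4. The weight enumerator is $\sum_i A_i x^i$, where $A_i$ is the number of codewords of Hamming weight $i$; in the displayed form, $\cdots$ stands for terms of higher degree, so the form specifies the coefficients of all powers of $x$ up to $x^{14}$. *)

(* Defs.v *)
From HB Require Import structures.
From mathcomp Require Import all_boot all_order all_algebra.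
Set Implicit Arguments.
Unset Strict Implicit.
Unset Printing Implicit Defensive.
Import GRing.Theory.
Local Open Scope ring_scope.

Notation binary_code n := {vspace 'rV['F_2]_n}.

Definition inner n (x y : 'rV['F_2]_n) : 'F_2 := \sum_(i < n) x 0 i * y 0 i.

Definition dual_code n (C : binary_code n) : {set 'rV['F_2]_n} :=
  [set x | [forall y, (y \in C) ==> (inner x y == 0)]].

Definition self_dual n (C : binary_code n) : Prop := C =i dual_code C.

Definition hamming_weight n (x : 'rV['F_2]_n) : nat := #|[set i | x 0 i != 0]|.

Definition hamming_distance n (x y : 'rV['F_2]_n) : nat :=
  #|[set i | x 0 i != y 0 i]|.

Definition has_min_distance n (C : binary_code n) (d : nat) : Prop :=
  (exists x y, [/\ x \in C, y \in C, x != y & hamming_distance x y = d]) /\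
  (forall x y, x \in C -> y \in C -> x != y -> (d <= hamming_distance x y)%N).

Definition is_nkd_code n (C : binary_code n) (k d : nat) : Prop :=
  \dim C = k /\ has_min_distance C d.

Definition singly_even n (C : binary_code n) : Prop :=
  ~ (forall x, x \in C -> (4 %| hamming_weight x)%N).

Definition weight_count n (C : binary_code n) (i : nat) : nat :=
  #|[set x : 'rV['F_2]_n | (x \in C) && (hamming_weight x == i)]|.

Definition weight_enumerator n (C : binary_code n) : {poly int} :=
  \poly_(i < n.+1) (weight_count C i)%:R.

(* The trailing dots of W_{64,2} are terms of degree > 14, so the form fixes
   exactly the coefficients of degree < 15, the absent ones being zero. *)
Definition has_form_W64_2 (alpha : int) (W : {poly int}) : Prop :=
  take_poly 15 W =
    1 + (1312 + 16 * alpha) *: 'X^12 + (23040 - 64 * alpha) *: 'X^14.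

(* Main.v *)
Require Import Defs.
From HB Require Import structures.
From mathcomp Require Import all_boot all_order all_algebra.
Set Implicit Arguments.
Unset Strict Implicit.
Unset Printing Implicit Defensive.
Import GRing.Theory.
Local Open Scope ring_scope.

(** The code is the graph {(x, x A)} of a 32 x 32 matrix A over F_2 with
A A^T = 1, built from sixteen 8 x 8 circulant blocks; it was found by a random
search among such matrices.  Since y = x A is equivalent to x = y A^T, a codeword
of weight at most 14 comes either from some x of weight at most 7 through A, or
from some y of weight at most 6 through A^T.  Both families are enumerated
exhaustively (about 5.7 million vectors), which gives the numbers of codewords
of all weights up to 14. *)

(** * Hamming weights, and counts by the weights of the two halves *)

Lemma hamming_weight_sum n (x : 'rV['F_2]_n) :
  hamming_weight x = (\sum_(i < n) (x 0%R i != 0%R))%N.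
Proof. by rewrite /hamming_weight cardsE -sum1_card big_mkcond. Qed.

Lemma hamming_weight_row_mx m n (x : 'rV['F_2]_m) (y : 'rV['F_2]_n) :
  hamming_weight (row_mx x y) = (hamming_weight x + hamming_weight y)%N.
Proof.
rewrite !hamming_weight_sum big_split_ord.
by congr (_ + _)%N; apply: eq_bigr => i _; rewrite ?row_mxEl ?row_mxEr.
Qed.

Lemma hamming_weight_eq0 n (x : 'rV['F_2]_n) :
  (hamming_weight x == 0%N) = (x == 0).
Proof.
rewrite /hamming_weight cards_eq0; apply/eqP/eqP => [x0|->].
  by apply/rowP=> i; move/setP/(_ i): x0; rewrite !inE mxE => /negbFE/eqP.
by apply/setP=> i; rewrite !inE mxE eqxx.
Qed.

Lemma hamming_weight0 n : hamming_weight (0 : 'rV['F_2]_n) = 0%N.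
Proof. by apply/eqP; rewrite hamming_weight_eq0. Qed.

(* The number of x of weight a such that u + x M has weight b. *)
Definition wsplit n p (M : 'M['F_2]_(n, p)) (u : 'rV_p) (a b : nat) : nat :=
  \sum_(x : 'rV_n)
    ((hamming_weight x == a) && (hamming_weight (u + x *m M) == b)).

Lemma big_rV_F2 n (F : 'rV['F_2]_(1 + n) -> nat) :
  (\sum_x F x = \sum_(x : 'rV_n) F (row_mx 0%R x)
                + \sum_(x : 'rV_n) F (row_mx 1%:M%R x))%N.
Proof.
pose h (cx : 'F_2 * 'rV['F_2]_n) := row_mx cx.1%:M cx.2 : 'rV_(1 + n).
have hK : bijective h.
  exists (fun v => (lsubmx v 0 0, rsubmx v)) => [[c x]|v] /=.
    by rewrite /h row_mxKl row_mxKr mxE.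
  by rewrite /h /= -mx11_scalar hsubmxK.
rewrite (reindex h) /=; last exact: onW_bij.
rewrite -(pair_big xpredT xpredT (fun c x => F (h (c, x)))) /=.
have F2E (G : 'F_2 -> nat) : (\sum_c G c = G 0%R + G 1%R)%N.
  by rewrite (big_ord_recl 1) big_ord1; congr (G _ + G _)%N; apply: val_inj.
by rewrite F2E /h /= raddf0.
Qed.

(** Split on the first coordinate of [x]: a 0 drops the row [r], a 1 uses one unit of weight and
    moves [r] into the offset. The enumeration follows this recursion. *)
Lemma wsplit_col_mx n p (r : 'rV_p) (M : 'M_(n, p)) u a b :
  wsplit (col_mx r M) u a.+1 b = (wsplit M u a.+1 b + wsplit M (u + r) a b)%N.
Proof.
rewrite /wsplit big_rV_F2; congr (_ + _)%N; apply: eq_bigr => x _.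
  by rewrite hamming_weight_row_mx mul_row_col mul0mx add0r hamming_weight0.
rewrite hamming_weight_row_mx mul_row_col mul1mx addrA hamming_weight_sum.
by rewrite big_ord1 mxE.
Qed.

Lemma wsplit_weight0 n p (M : 'M_(n, p)) u b :
  wsplit M u 0 b = (hamming_weight u == b).
Proof.
rewrite /wsplit (bigD1 0) //= big1 ?addn0 => [|x /negPf x0].
  by rewrite mul0mx addr0 hamming_weight_eq0 eqxx.
by rewrite hamming_weight_eq0 x0.
Qed.

Lemma wsplit_norows p (M : 'M_(0, p)) u a b : wsplit M u a.+1 b = 0%N.
Proof. by rewrite /wsplit big1 // => x _; rewrite hamming_weight_sum big_ord0. Qed.

(** * Enumeration of sums of rows over Boolean words *)

Definition row_of p (w : seq bool) : 'rV['F_2]_p := \row_j (nth false w j)%:R.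

Definition mx_of n p (rs : seq (seq bool)) : 'M['F_2]_(n, p) :=
  \matrix_(i, j) (nth false (nth [::] rs i) j)%:R.

Lemma mx_of_cons n p r rs : mx_of n.+1 p (r :: rs) = col_mx (row_of p r) (mx_of n p rs).
Proof.
apply/matrixP=> i j; case: (@split_ordP 1 n i) => k ->.
  by rewrite [RHS]col_mxEu !mxE ord1.
by rewrite [RHS]col_mxEd !mxE.
Qed.

Lemma F2_natr_bool_neq0 (b : bool) : (b%:R != 0 :> 'F_2) = b.
Proof. by case: b. Qed.

Lemma hamming_weight_row_of p w : size w = p -> hamming_weight (row_of p w) = count id w.
Proof.
move=> <-; rewrite hamming_weight_sum -sumn_count sumnE big_map big_tnth.
by apply: eq_bigr => i _; rewrite !mxE F2_natr_bool_neq0 (tnth_nth false).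
Qed.

Fixpoint xorw (u v : seq bool) : seq bool :=
  match u, v with
  | a :: u', b :: v' => (if a then ~~ b else b) :: xorw u' v'
  | _, _ => [::]
  end.

Lemma size_xorw u v : size u = size v -> size (xorw u v) = size v.
Proof. by elim: u v => [|a u IHu] [|b v] //= [/IHu ->]. Qed.

Lemma nth_xorw u v i : size u = size v ->
  nth false (xorw u v) i = nth false u i (+) nth false v i.
Proof.
by elim: u v i => [|a u IHu] [|b v] [|i] //= [suv]; rewrite ?nth_nil ?IHu //; case: a.
Qed.

Lemma row_of_xorw p u v : size u = size v ->
  row_of p (xorw u v) = row_of p u + row_of p v.
Proof.
move=> suv; apply/rowP => j; rewrite !mxE nth_xorw //.
by case: (nth _ u j) (nth _ v j) => [] []; apply: val_inj.
Qed.

(* Pushes m - d on out if the Hamming distance d of u and v is at most m; the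
   early exit once m is exhausted is what makes the enumeration affordable. *)
Fixpoint push_slack (u v : seq bool) (m : nat) (out : seq nat) : seq nat :=
  match u, v with
  | a :: u', b :: v' =>
    if (if a then b else ~~ b) then push_slack u' v' m out
    else if m is m'.+1 then push_slack u' v' m' out else out
  | _, _ => m :: out
  end.

Lemma push_slackE u v m out :
  push_slack u v m out =
    let d := count id (xorw u v) in if (d <= m)%N then (m - d)%N :: out else out.
Proof.
elim: u v m => [|a u IHu] [|b v] m //=; rewrite ?subn0 //.
by case: a b m => [] [] [|m] /=; rewrite ?IHu ?add0n ?add1n ?ltnS ?subSS.
Qed.

(* The values m - wt(u + s) >= 0, for s running over the sums of k + 1 rows of rs. *)
Fixpoint slacks (k m : nat) (rs : seq (seq bool)) (u : seq bool) (out : seq nat) :=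
  match k with
  | 0 => (fix scan (rs : seq (seq bool)) : seq nat :=
            if rs is r :: rs' then push_slack u r m (scan rs') else out) rs
  | k'.+1 => (fix branch (rs : seq (seq bool)) : seq nat :=
            if rs is r :: rs' then slacks k' m rs' (xorw u r) (branch rs') else out) rs
  end%N.

(** Both levels of [slacks] skip the first row or add it to the offset, as in [wsplit_col_mx]. Since
    [b <= m], truncated subtraction loses nothing: among the recorded weights, which are at most
    [m], only [b] gives the slack [m - b]. *)
Lemma count_slacks k m p rs u out b : (b <= m)%N ->
    size u = p -> {in rs, forall r, size r = p} ->
  count_mem (m - b)%N (slacks k m rs u out) =
    (wsplit (mx_of (size rs) p rs) (row_of p u) k.+1 b + count_mem (m - b)%N out)%N.
Proof.
move=> lebm; elim: k rs u out => [|k IHk] rs u out su; elim: rs => [|r rs IHrs] srs /=.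
- by rewrite wsplit_norows.
- have sr : size r = p by apply: srs; rewrite mem_head.
  have {}srs : {in rs, forall r, size r = p} by move=> w wrs; rewrite srs // inE wrs orbT.
  rewrite mx_of_cons wsplit_col_mx wsplit_weight0 -row_of_xorw ?su //.
  rewrite hamming_weight_row_of ?size_xorw ?su // push_slackE /=.
  rewrite addnAC -(IHrs srs).
  set d := count id (xorw u r); case: (leqP d m) => [ledm|ltmd] /=; last first.
    by rewrite (gtn_eqF (leq_ltn_trans lebm ltmd)) addn0.
  rewrite addnC; congr (_ + _)%N; congr nat_of_bool.
  by apply/eqP/eqP => [/(congr1 (subn m))|->] //; rewrite !subKn.
- by rewrite wsplit_norows.
have sr : size r = p by apply: srs; rewrite mem_head.
have {}srs : {in rs, forall r, size r = p} by move=> w wrs; rewrite srs // inE wrs orbT.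
rewrite mx_of_cons wsplit_col_mx IHk //; last by rewrite size_xorw ?sr.
by rewrite IHrs // row_of_xorw ?su // addnCA addnA.
Qed.

(** * Graph codes of orthogonal matrices *)

Definition graph_map n (A : 'M['F_2]_n) (x : 'rV['F_2]_n) : 'rV_(n + n) :=
  row_mx x (x *m A).

Fact graph_map_is_linear n A : linear (@graph_map n A).
Proof. by move=> c x y; rewrite /graph_map mulmxDl -scalemxAl scale_row_mx add_row_mx. Qed.

HB.instance Definition _ n A :=
  GRing.isLinear.Build 'F_2 'rV['F_2]_n 'rV['F_2]_(n + n) _ (@graph_map n A)
    (@graph_map_is_linear n A).

Definition graph_code n (A : 'M['F_2]_n) : binary_code (n + n) :=
  limg (linfun (graph_map A)).

Lemma mem_graph_code n (A : 'M_n) x y : (row_mx x y \in graph_code A) = (y == x *m A).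
Proof.
apply/memv_imgP/eqP => [[z _]|->].
  by rewrite lfunE => /eq_row_mx[-> ->].
by exists x; rewrite ?memvf // lfunE.
Qed.

Lemma dim_graph_code n (A : 'M_n) : \dim (graph_code A) = n.
Proof.
rewrite limg_dim_eq ?dimvf /dim /= ?mul1n //.
apply/eqP; rewrite capfv; apply/lker0P => x y; rewrite !lfunE.
by case/eq_row_mx.
Qed.

Lemma oppmx_F2 m n (M : 'M['F_2]_(m, n)) : - M = M.
Proof. by apply/matrixP => i j; rewrite mxE oppr_pchar2. Qed.

Lemma inner_mulmx n (x y : 'rV['F_2]_n) : inner x y = (x *m y^T) 0 0.
Proof. by rewrite mxE; apply: eq_bigr => i _; rewrite mxE. Qed.

(** The inner product of (x, xA) and (y, yA) is x y^T + x A A^T y^T = 2 x y^T = 0. Conversely, if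
    (a, b) is orthogonal to every (x, xA), then a + b A^T kills every x^T, so a = b A^T and b =
    aA. *)
Lemma graph_code_self_dual n (A : 'M_n) : A *m A^T = 1%:M -> self_dual (graph_code A).
Proof.
move=> AAt z; have AtA := mulmx1C AAt.
rewrite -[z]hsubmxK; set a := lsubmx z; set b := rsubmx z.
rewrite mem_graph_code inE; apply/eqP/forallP => [-> y|dual_ab].
  apply/implyP; rewrite -[y]hsubmxK mem_graph_code => /eqP->.
  rewrite inner_mulmx tr_row_mx mul_row_col trmx_mul mulmxA -(mulmxA a) AAt mulmx1.
  by rewrite -[X in X + _]oppmx_F2 addNr mxE.
have {dual_ab} dual_ab (x : 'rV_n) : ((a + b *m A^T) *m x^T) 0 0 = 0.
  have := dual_ab (row_mx x (x *m A)); rewrite mem_graph_code eqxx inner_mulmx.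
  by rewrite tr_row_mx mul_row_col trmx_mul mulmxA mulmxDl => /eqP.
suff /eqP : a + b *m A^T = 0.
  by rewrite addr_eq0 oppmx_F2 => /eqP->; rewrite -mulmxA AtA mulmx1.
apply/rowP => i; have := dual_ab (delta_mx 0 i).
by rewrite trmx_delta -colE !mxE.
Qed.

(** A codeword is determined by its left half x, and x contributes only to the term where [a] is the
    weight of x. *)
Lemma weight_count_graph_code n (A : 'M_n) w :
  weight_count (graph_code A) w = (\sum_(a < w.+1) wsplit A 0%R a (w - a))%N.
Proof.
transitivity (\sum_x ((hamming_weight x + hamming_weight (x *m A))%N == w))%N.
  rewrite /weight_count cardsE -sum1_card big_mkcond /=.
  rewrite (reindex (fun p : 'rV_n * 'rV_n => row_mx p.1 p.2)) /=; last first.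
    by exists (fun v => (lsubmx v, rsubmx v)) => [[x y]|v] _ /=;
      rewrite ?row_mxKl ?row_mxKr ?hsubmxK.
  rewrite -(pair_big xpredT xpredT (fun x y => if (row_mx x y \in graph_code A)
    && (hamming_weight (row_mx x y) == w) then 1 else 0)%N) /=.
  apply: eq_bigr => x _; rewrite (bigD1 (x *m A)) //= big1 ?addn0 => [|y /negPf yxA].
    by rewrite mem_graph_code eqxx hamming_weight_row_mx.
  by rewrite mem_graph_code yxA.
rewrite /wsplit exchange_big; apply: eq_bigr => x _ /=; rewrite add0r.
case: (leqP (hamming_weight x) w) => [lexw|ltwx]; last first.
  rewrite gtn_eqF ?ltn_addr // big1 // => a _.
  by rewrite gtn_eqF // (leq_trans (ltn_ord a)).
rewrite (bigD1 (Ordinal (lexw : (_ < w.+1)%N))) //= eqxx big1 ?addn0 => [|a].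
  by rewrite -{1}(subnKC lexw) eqn_add2l.
by rewrite -val_eqE eq_sym => /negPf/= ->.
Qed.

(** Substituting x = y A^T swaps the two halves, so words with a heavy left half can be counted
    through their light right half. *)
Lemma wsplit_trmx n (A : 'M_n) a b :
  A *m A^T = 1%:M -> wsplit A 0 a b = wsplit A^T 0 b a.
Proof.
move=> AAt; have AtA := mulmx1C AAt.
rewrite /wsplit (reindex (fun y => y *m A^T)) /=; last first.
  by exists (fun x => x *m A) => x _; rewrite -mulmxA ?AAt ?AtA mulmx1.
by apply: eq_bigr => y _; rewrite !add0r -mulmxA AtA mulmx1 andbC.
Qed.

(** * The explicit matrix and its low-weight counts *)

Definition byte (c : nat) : seq bool := [seq odd (c %/ 2 ^ k) | k <- iota 0 8].

(* Bit k of the byte in position (i, j) is the entry in column k of the first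
   row of the circulant block (i, j) of A. *)
Definition circulants : seq (seq nat) :=
  [:: [:: 4; 181; 4; 95]; [:: 165; 145; 247; 174];
      [:: 74; 79; 245; 67]; [:: 47; 119; 173; 55]]%N.

Definition rowsA : seq (seq bool) :=
  [seq flatten [seq rotr h (byte c) | c <- cs] | cs <- circulants, h <- iota 0 8].

Definition colsA : seq (seq bool) :=
  mkseq (fun j => mkseq (fun i => nth false (nth [::] rowsA i) j) 32) 32.

(* Entry s is the number of x of weight a > 0 such that the pair formed by x and
   its image under the matrix with rows rs has total weight 14 - s. *)
Definition slack_profile (rs : seq (seq bool)) (a : nat) : seq nat :=
  let l := slacks a.-1 (14 - a) rs (nseq 32 false) [::] in
  [seq count_mem s l | s <- iota 0 15].

Definition matA : 'M['F_2]_32 := mx_of 32 32 rowsA.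

Lemma trmx_matA : matA^T = mx_of 32 32 colsA.
Proof. by apply/matrixP => i j; rewrite !mxE /colsA !nth_mkseq. Qed.

Lemma F2_natr_odd k : k%:R = (odd k)%:R :> 'F_2.
Proof. by apply: val_inj; rewrite /= !val_Fp_nat // modn2; case: odd. Qed.

Lemma mx_of_gram n p rs i j :
  (mx_of n p rs *m (mx_of n p rs)^T) i j =
    (odd (sumn [seq (nth false (nth [::] rs i) k && nth false (nth [::] rs j) k : nat)
               | k <- iota 0 p]))%:R.
Proof.
rewrite mxE -F2_natr_odd sumnE big_map natr_sum -[in iota _ _](subn0 p) big_mkord.
by apply: eq_bigr => k _; rewrite !mxE -natrM mulnb.
Qed.

Lemma matA_unitary : matA *m matA^T = 1%:M.
Proof.
pose dot i j := odd (sumn [seq (nth false (nth [::] rowsA i) k &&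
                                nth false (nth [::] rowsA j) k : nat) | k <- iota 0 32]).
have gram : all (fun i => all (fun j => dot i j == (i == j)) (iota 0 32)) (iota 0 32).
  by vm_cast_no_check (erefl true).
have mem_ord (k : 'I_32) : val k \in iota 0 32 by rewrite mem_iota ltn_ord.
apply/matrixP => i j; rewrite mx_of_gram !mxE -/(dot i j).
by have /eqP-> := allP (allP gram _ (mem_ord i)) _ (mem_ord j).
Qed.

(** Position s stands for total weight 14 - s, so the fixed zeros exclude weight 13 and all weights
    below 12. *)
Definition profile_low (w14 w12 : nat) : seq nat := [:: w14; 0; w12] ++ nseq 12 0.

Definition profilesA : seq (seq nat) :=
  [:: profile_low 8 0; profile_low 56 16; profile_low 320 88; profile_low 1024 264;
      profile_low 2240 272; profile_low 4104 824; profile_low 4600 304]%N.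

Definition profilesAt : seq (seq nat) :=
  [:: profile_low 8 0; profile_low 56 24; profile_low 232 88; profile_low 928 280;
      profile_low 2192 304; profile_low 3880 824]%N.

Lemma slack_profiles_rowsA : [seq slack_profile rowsA a | a <- iota 1 7] = profilesA.
Proof. by vm_cast_no_check (erefl profilesA). Qed.

Lemma slack_profiles_colsA : [seq slack_profile colsA b | b <- iota 1 6] = profilesAt.
Proof. by vm_cast_no_check (erefl profilesAt). Qed.

Lemma row_of_nseq0 p : row_of p (nseq p false) = 0.
Proof. by apply/rowP => j; rewrite !mxE nth_nseq ltn_ord. Qed.

Lemma nth_slack_profile rs a b :
    size rs = 32%N -> all (fun r => size r == 32%N) rs -> (0 < a)%N -> (a + b <= 14)%N ->
  nth 0%N (slack_profile rs a) (14 - (a + b)) = wsplit (mx_of 32 32 rs) 0 a b.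
Proof.
case: a => // a srs /allP sz _ leab.
have {}sz : {in rs, forall r, size r = 32%N} by move=> r /sz/eqP.
rewrite (nth_map 0%N) ?size_iota ?ltnS ?leq_subr // nth_iota ?ltnS ?leq_subr // add0n.
(* With bound 14 - a, weight b leaves the slack (14 - a) - b = 14 - (a + b). *)
rewrite subnDA (@count_slacks a _ 32) ?size_nseq //; last by rewrite leq_subRL // (leq_trans (leq_addr b _) leab).
by rewrite addn0 srs row_of_nseq0.
Qed.

(** If a > 7 and a + b <= 14, then b <= 6, so the tables for A and A^T cover all cases. Zero halves
    are treated apart because [slacks] never forms the empty sum of rows. *)
Definition split_count (a b : nat) : nat :=
  if a == 0%N then (b == 0%N : nat) else
  if (a <= 7)%N then nth 0%N (nth [::] profilesA a.-1) (14 - (a + b)) else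
  if b == 0%N then 0%N else nth 0%N (nth [::] profilesAt b.-1) (14 - (a + b)).

Lemma wsplit_matA a b : (a + b <= 14)%N -> wsplit matA 0 a b = split_count a b.
Proof.
move=> leab; rewrite /split_count; case: posnP => [->|a_gt0].
  by rewrite wsplit_weight0 hamming_weight0 eq_sym.
case: leqP => [lea7|lt7a].
  rewrite -slack_profiles_rowsA (nth_map 0%N) ?size_iota ?prednK // nth_iota ?prednK //.
  rewrite add1n prednK // nth_slack_profile //.
rewrite (wsplit_trmx _ _ matA_unitary); case: posnP => [->|b_gt0].
  by rewrite wsplit_weight0 hamming_weight0 (ltn_eqF a_gt0).
have leb6 : (b <= 6)%N by rewrite -(leq_add2l 8) (leq_trans _ leab) // leq_add2r.
rewrite -slack_profiles_colsA (nth_map 0%N) ?size_iota ?prednK // nth_iota ?prednK //.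
by rewrite add1n prednK // addnC nth_slack_profile ?trmx_matA // addnC.
Qed.

(** Here 2160 = 1312 + 16 * 53 and 19648 = 23040 - 64 * 53. *)
Definition low_weights : seq nat :=
  [:: 1; 0; 0; 0; 0; 0; 0; 0; 0; 0; 0; 0; 2160; 0; 19648]%N.

Lemma weight_count_matA w : (w <= 14)%N ->
  weight_count (graph_code matA) w = nth 0%N low_weights w.
Proof.
move=> lew14; rewrite weight_count_graph_code.
have -> : (\sum_(a < w.+1) wsplit matA 0%R a (w - a) =
           sumn [seq split_count a (w - a) | a <- iota 0 w.+1])%N.
  rewrite -(big_mkord xpredT (fun a => wsplit matA 0%R a (w - a))) /index_iota subn0.
  rewrite sumnE big_map; apply: eq_big_seq => a; rewrite mem_iota ltnS => leaw.
  by rewrite wsplit_matA // subnKC.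
have : all (fun w => sumn [seq split_count a (w - a) | a <- iota 0 w.+1]
                     == nth 0%N low_weights w) (iota 0 15) by vm_compute.
by move/allP/(_ w); rewrite mem_iota => /(_ lew14)/eqP.
Qed.

(** * Minimum distance and weight enumerator *)

Lemma weight_count_gt0 n (C : binary_code n) w :
  (0 < weight_count C w)%N -> exists2 x, x \in C & hamming_weight x = w.
Proof. by case/card_gt0P => x; rewrite inE => /andP[Cx /eqP]; exists x. Qed.

Lemma hamming_distance_weight n (x y : 'rV['F_2]_n) :
  hamming_distance x y = hamming_weight (x - y).
Proof. by apply: eq_card => i; rewrite !inE !mxE subr_eq0. Qed.

Lemma has_min_distance_weight_count n (C : binary_code n) d : (0 < d)%N ->
    (0 < weight_count C d)%N -> (forall w, (0 < w < d)%N -> weight_count C w = 0%N) ->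
  has_min_distance C d.
Proof.
move=> d_gt0 /weight_count_gt0[x Cx wx] no_light; split=> [|y z Cy Cz yz].
  exists x, 0; rewrite Cx mem0v hamming_distance_weight subr0 wx; split=> //.
  by rewrite -hamming_weight_eq0 wx -lt0n.
rewrite hamming_distance_weight leqNgt; apply/negP => ltd.
have := no_light (hamming_weight (y - z)).
rewrite ltd lt0n hamming_weight_eq0 subr_eq0 yz => /(_ isT)/eqP.
by rewrite cards_eq0 => /eqP/setP/(_ (y - z)); rewrite !inE memvB ?eqxx.
Qed.

Theorem mainTheorem4 :
  exists C : binary_code 64,
    [/\ is_nkd_code C 32 12,
        self_dual C,
        singly_even C &
        has_form_W64_2 53 (weight_enumerator C)].
Proof.
exists (graph_code matA); split.
- split; first exact: (dim_graph_code matA).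
  apply: has_min_distance_weight_count => // [|w /andP[w0 w12]].
    by rewrite weight_count_matA.
  rewrite weight_count_matA ?(leq_trans (ltnW w12)) //.
  (* Entries 1 to 11 of [low_weights] are zero; they are checked one at a time. *)
  by do 12?[case: w w0 w12 => // w w0 w12].
- exact: (graph_code_self_dual matA_unitary).
(* There are words of weight 14, which is not a multiple of 4. *)
- have [|x Cx wx] := @weight_count_gt0 _ (graph_code matA) 14.
    by rewrite weight_count_matA.
  by move/(_ x Cx); rewrite wx.
apply/polyP => i; rewrite coef_take_poly !coefD !coefZ !coefXn coef1.
case: ltnP => [lti15|le15i]; last first.
  (* Beyond degree 14 both monomials vanish whatever their coefficients, which are therefore
     abstracted. *)
  move: (1312 + _) (23040 - _) => c12 c14.
  by rewrite !gtn_eqF ?(leq_trans _ le15i) //= !mulr0 !addr0.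
rewrite coef_poly (ltn_trans lti15) // weight_count_matA // [LHS]natz.
have /allP coefE : all (fun i => Posz (nth 0%N low_weights i) ==
    (i == 0%N)%:R + (1312 + 16 * 53) * (i == 12)%:R + (23040 - 64 * 53) * (i == 14)%:R)
  (iota 0 15) by vm_compute.
by apply/eqP/coefE; rewrite mem_iota.
Qed.
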